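(* Let $t\ge 1$ and $2\le \ell\le 5$ be integers. Then $\chi_p(P_{\ell t}\Diamond_\ell K_5)\le 14$.
   Context: A packing $k$-coloring of a graph $H$ is a map $c:V(H)\to\{1,\ldots,k\}$ such that any two distinct vertices $u,v$ with $c(u)=c(v)=i$ satisfy $d_H(u,v)\ge i+1$. The packing chromatic number $\chi_p(H)$ is the least such $k$. $P_m$ denotes the path $v_1\cdots v_m$ and $K_n$ the complete graph on $n$ vertices. Path-aligned product: for positive integers $\ell\mid m$ and a connected vertex-transitive graph $G$ containing $P_\ell$ as a subgraph, $P_m\Diamond_\ell G$ is formed from the path $P_m=v_1\cdots v_m$ and $m/\ell$ pairwise disjoint copies of $G$, where for each $1\le i\le m/\ell$ the consecutive path vertices $v_{(i-1)\ell+1},\ldots,v_{i\ell}$ are identified, in order, with $\ell$ distinct vertices of the $i$-th copy of $G=K_n$. Consecutive copies are joined only by the path edges $v_{i\ell}v_{i\ell+1}$. *)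

(* Defs.v *)
From HB Require Import structures.
From mathcomp Require Import all_boot.
Set Implicit Arguments.
Unset Strict Implicit.
Unset Printing Implicit Defensive.

Record sgraph := SGraph {
  vert :> finType;
  adj : rel vert;
  adj_sym : symmetric adj;
  adj_irrefl : irreflexive adj }.

Arguments adj {s} _ _.

Section Distance.
Variable G : sgraph.

Definition walk (u v : G) (n : nat) : bool :=
  [exists p : n.-tuple G, path adj u p && (last u p == v)].

Lemma walk_ex (u v : G) : connect adj u v -> exists n, walk u v n.
Proof.
case/connectP=> p up ->; exists (size p).
by apply/existsP; exists (in_tuple p); rewrite up eqxx.
Qed.

(* [None] stands for infinite distance. *)
Definition dist (u v : G) : option nat :=
  match @idP (connect adj u v) with
  | ReflectT uv => Some (ex_minn (walk_ex uv))
  | ReflectF _ => None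
  end.

Definition dist_ge (u v : G) (n : nat) : bool :=
  if dist u v is Some d then n <= d else true.

End Distance.

Section PackingColoring.
Variable G : sgraph.

(* Colours 1..k are encoded by 'I_k: the vertex u has colour (c u).+1. *)
Definition packing_coloring (k : nat) (c : {ffun G -> 'I_k}) : bool :=
  [forall u, forall v,
     (u != v) ==> (c u == c v) ==> dist_ge u v ((c u).+1 + 1)].

Definition packing_colorable (k : nat) : bool :=
  [exists c : {ffun G -> 'I_k}, packing_coloring c].

Lemma packing_colorable_ex : exists k, packing_colorable k.
Proof.
exists #|G|; apply/existsP; exists [ffun u => enum_rank u].
apply/forallP=> u; apply/forallP=> v; rewrite !ffunE.
by rewrite (inj_eq enum_rank_inj); case: (u == v).
Qed.

Definition packing_chromatic_number : nat := ex_minn packing_colorable_ex.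

End PackingColoring.

Section CompleteGraph.
Variable n : nat.

Definition complete_adj : rel 'I_n := fun i j => i != j.

Fact complete_adj_sym : symmetric complete_adj.
Proof. by move=> i j; rewrite /complete_adj eq_sym. Qed.

Fact complete_adj_irrefl : irreflexive complete_adj.
Proof. by move=> i; rewrite /complete_adj eqxx. Qed.

Definition complete_graph : sgraph := SGraph complete_adj_sym complete_adj_irrefl.

End CompleteGraph.

Section PathGraph.
Variable m : nat.

Definition path_adj : rel 'I_m :=
  fun a b => (b == a.+1 :> nat) || (a == b.+1 :> nat).

Fact path_adj_sym : symmetric path_adj.
Proof. by move=> a b; rewrite /path_adj orbC. Qed.

Fact path_adj_irrefl : irreflexive path_adj.
Proof. by move=> a; rewrite /path_adj orbb ltn_eqF. Qed.

(* The vertex v_k of P_m is the ordinal k - 1. *)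
Definition path_graph : sgraph := SGraph path_adj_sym path_adj_irrefl.

End PathGraph.

(* A copy of H as a (not necessarily induced) subgraph of G. *)
Record subgraph_copy (H G : sgraph) := SubgraphCopy {
  copy_map :> H -> G;
  copy_inj : injective copy_map;
  copy_adj : forall x y, adj x y -> adj (copy_map x) (copy_map y) }.

(* The product of P_m and G along paths on l vertices; it is meant for 0 < l and
   l %| m.  For each i < m %/ l, [phi i] is the copy of P_l in the i-th copy of
   G with which the i-th block of l consecutive vertices of P_m is identified,
   so that every vertex of P_m is a vertex of one of the copies of G. *)
Section PathAlignedProduct.
Variables (m l : nat) (G : sgraph).
Variable phi : 'I_(m %/ l) -> subgraph_copy (path_graph l) G.

Definition identified (a : path_graph m) (w : 'I_(m %/ l) * G) : bool :=
  [exists j : path_graph l, (a == w.1 * l + j :> nat) && (w.2 == phi w.1 j)].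

Definition pap_adj : rel ('I_(m %/ l) * G)%type := fun w w' =>
  (w.1 == w'.1) && adj w.2 w'.2
  || [exists a : path_graph m, exists b : path_graph m,
        [&& adj a b, identified a w & identified b w']].

Fact pap_adj_sym : symmetric pap_adj.
Proof.
suff H w w' : pap_adj w w' -> pap_adj w' w by move=> w w'; apply/idP/idP; apply: H.
case/orP=> [/andP[/eqP e aw]|/existsP[a /existsP[b /and3P[ab aw bw]]]]; apply/orP.
  by left; rewrite e eqxx adj_sym.
by right; apply/existsP; exists b; apply/existsP; exists a; rewrite adj_sym ab aw bw.
Qed.

Fact pap_adj_irrefl : irreflexive pap_adj.
Proof.
move=> w; rewrite /pap_adj adj_irrefl andbF /=.
apply/negbTE/negP=> /existsP[a /existsP[b /and3P[ab]]].
case/existsP=> j /andP[/eqP aE /eqP wj] /existsP[j' /andP[/eqP bE /eqP wj']].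
have jj' : j = j' by apply: (@copy_inj _ _ (phi w.1)); rewrite -wj -wj'.
have ab_eq : a = b by apply: val_inj; rewrite /= aE bE jj'.
by move: ab; rewrite ab_eq path_adj_irrefl.
Qed.

Definition path_aligned_product : sgraph := SGraph pap_adj_sym pap_adj_irrefl.

End PathAlignedProduct.

(* Main.v *)
(** In a chain of complete graphs only the first and last identified vertices
    of a copy (its entry and exit) matter: vertices [u], [v] of copies [i < j]
    are at distance [(u <> exit) + 2 (j - i) - 1 + (v <> entry)].  Hence an even
    colour [c] used only on vertices that are neither entry nor exit, and an odd
    colour [c] that avoids the exits (or is used on exits only), may recur in
    every [ceil(c / 2)]-th copy.  As [2 (1 + 1/2 + ... + 1/7) > 5], fourteen
    colours have the density needed for five vertices per copy, and a search
    gives a colouring of period 12. *)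
Require Import Defs.
From mathcomp Require Import all_boot zify.
Set Implicit Arguments.
Unset Strict Implicit.
Unset Printing Implicit Defensive.

Lemma dist_ge_lipschitz (G : sgraph) (D : G -> G -> nat) (u v : G) (n : nat) :
    (forall w, D w w = 0) ->
    (forall w w' z, adj w w' -> D w z <= (D w' z).+1) ->
  n <= D u v -> dist_ge u v n.
Proof.
move=> D0 DS nD; rewrite /dist_ge /dist; case: {-}_ / idP => // uv.
case: ex_minnP => d /existsP[p /andP[up /eqP lp]] _.
apply: leq_trans nD _; case: p up lp => s /= /eqP <-.
elim: s u {uv} => [|w s IH] u /=; first by move=> _ ->; rewrite D0.
by case/andP=> /DS uw wp lp; apply: leq_trans (uw v) _; rewrite ltnS IH.
Qed.

Lemma packing_chromatic_number_le (G : sgraph) (k : nat) :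
  packing_colorable G k -> packing_chromatic_number G <= k.
Proof. by rewrite /packing_chromatic_number; case: ex_minnP => m _; apply. Qed.

Section CompleteChain.
Variables (m l n : nat).
Variable phi : 'I_(m %/ l.+2) -> subgraph_copy (path_graph l.+2) (complete_graph n).
Let H := path_aligned_product phi.

Definition entry i : 'I_n := phi i ord0.
Definition exit i : 'I_n := phi i ord_max.

Lemma entry_neq_exit i : entry i != exit i.
Proof. by apply/eqP => /(@copy_inj _ _ (phi i)) /(congr1 val). Qed.

Lemma chain_adj (w w' : H) : adj w w' ->
  [\/ w.1 = w'.1 /\ w.2 != w'.2,
      [/\ w'.1 = w.1.+1 :> nat, w.2 = exit w.1 & w'.2 = entry w'.1] |
      [/\ w.1 = w'.1.+1 :> nat, w'.2 = exit w'.1 & w.2 = entry w.1]].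
Proof.
suff link (a b : path_graph m) (z z' : H) : identified phi a z ->
    identified phi b z' -> b = a.+1 :> nat ->
    z.1 = z'.1 /\ z.2 != z'.2 \/
    [/\ z'.1 = z.1.+1 :> nat, z.2 = exit z.1 & z'.2 = entry z'.1].
  case/orP=> [/andP[/eqP e ne]|]; first by apply: Or31.
  case/existsP=> a /existsP[b /and3P[/orP[] /eqP ab wa wb]].
    by case: (link _ _ _ _ wa wb ab) => ?; [apply: Or31 | apply: Or32].
  case: (link _ _ _ _ wb wa ab) => [[e ne]|?]; last exact: Or33.
  by apply: Or31; rewrite e eq_sym.
case: z z' => [i u] [i' u'] /existsP[j /andP[/eqP /= -> /eqP ->]].
case/existsP=> j' /andP[/eqP /= -> /eqP ->] E.
have jl : j < l.+2 by []. have jl' : j' < l.+2 by [].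
have [ii'|ii'] := eqVneq i i'; [left|right].
  split=> //; subst i'; apply/eqP => /(@copy_inj _ _ (phi i)) jj'.
  by move: E; rewrite jj'; lia.
have {ii'} ne : i <> i' :> nat by move=> e; case/eqP: ii'; apply: val_inj.
have ei : i' = i.+1 :> nat by nia.
split=> //; rewrite /exit /entry; congr (phi _ _); apply: val_inj => /=.
  by move: E; rewrite ei; lia.
by move: E; rewrite ei; lia.
Qed.

Definition chain_dist (w z : H) : nat :=
  if w.1 < z.1 then (w.2 != exit w.1) + (z.1 - w.1).*2.-1 + (z.2 != entry z.1)
  else if z.1 < w.1 then
    (z.2 != exit z.1) + (w.1 - z.1).*2.-1 + (w.2 != entry w.1)
  else w.2 != z.2.

Lemma chain_dist_adj (w w' z : H) :
  adj w w' -> chain_dist w z <= (chain_dist w' z).+1.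
Proof.
have bool_le1 (b : bool) : b <= 1 by case: b.
case/chain_adj; case: w w' z => [i u] [i' u'] [j v]; rewrite /chain_dist /=.
- case=> <- ne; case: (ltngtP i j) => _ //.
  + by have := bool_le1 (u != exit i); lia.
  + by have := bool_le1 (u != entry i); lia.
  + by have := bool_le1 (u != v); lia.
- case=> ei -> ->; rewrite eqxx ei entry_neq_exit [exit i == entry i]eq_sym.
  rewrite entry_neq_exit; case: (ltngtP i j) => [ij|ij|/val_inj <-].
  + case: (ltngtP i.+1 j) => [ij'|ij'|ij']; try lia.
    have <- : i' = j by apply: val_inj; rewrite /= ei.
    by rewrite [v == _]eq_sym ei subSnn; apply: leqnn.
  + by rewrite ltnNge (leqW (ltnW ij)) /= (leqW ij); lia.
  + rewrite ltnNge leqnSn /= ltnSn.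
    by have := bool_le1 (exit i != v); lia.
- case=> ei -> ->; rewrite eqxx ei entry_neq_exit [exit i' == entry i']eq_sym.
  rewrite entry_neq_exit; case: (ltngtP i'.+1 j) => [ij|ij|ij].
  + lia.
  + case: (ltngtP j i') => [ji|ji|/val_inj ->]; try lia.
    by rewrite [exit i' == _]eq_sym subSnn addn0 addn1.
  + have <- : i = j by apply: val_inj; rewrite /= ei.
    by have := bool_le1 (entry i != v); lia.
Qed.

Lemma chain_dist_ge (w z : H) k : k <= chain_dist w z -> dist_ge w z k.
Proof.
apply: dist_ge_lipschitz => [x|]; last exact: chain_dist_adj.
by rewrite /chain_dist ltnn eqxx.
Qed.

(* Position 0 is the entry of the copy and position 1 its exit. *)
Definition layout i : seq 'I_n :=
  [:: entry i, exit i & [seq v <- enum 'I_n | v \notin [:: entry i; exit i]]].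

Definition position (w : H) : nat := index w.2 (layout w.1).

Lemma mem_layout i v : v \in layout i.
Proof. by rewrite !inE mem_filter !inE mem_enum andbT; do 2!case: eqP. Qed.

Lemma uniq_layout i : uniq (layout i).
Proof.
rewrite /= inE !mem_filter !inE !eqxx orbT /= negb_or entry_neq_exit /=.
by rewrite filter_uniq ?enum_uniq.
Qed.

Lemma size_layout i : size (layout i) = n.
Proof.
rewrite -[RHS]card_ord cardE; apply/perm_size/uniq_perm.
- exact: uniq_layout.
- exact: enum_uniq.
- by move=> v; rewrite mem_layout mem_enum.
Qed.

Lemma position_lt w : position w < n.
Proof. by rewrite -(size_layout w.1) index_mem mem_layout. Qed.

Lemma entryE (w : H) : (w.2 == entry w.1) = (position w == 0).
Proof. by rewrite /position /= eq_sym; case: eqP. Qed.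

Lemma exitE (w : H) : (w.2 == exit w.1) = (position w == 1).
Proof.
rewrite /position /= ![_ == w.2]eq_sym; have := entry_neq_exit w.1.
by case: (eqVneq w.2 (entry w.1)) => [<- /negbTE|_ _] //; case: eqP.
Qed.

Lemma position_inj (w z : H) : w.1 = z.1 -> position w = position z -> w = z.
Proof.
case: w z => [i u] [j v] /= <-; rewrite /position /= -/(layout i) => e.
have := nth_index u (mem_layout i u); rewrite [index u _]e.
by rewrite (nth_index u (mem_layout i v)) => ->.
Qed.

End CompleteChain.

(* Row [i] lists the colours of a copy with index congruent to [i] modulo 12 in
   the order entry, exit, others. *)
Definition pattern : seq (seq nat) :=
  [:: [:: 3; 1; 2; 6; 8];   [:: 7; 1; 2; 4; 11];  [:: 3; 1; 2; 5; 10];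
      [:: 13; 1; 2; 4; 6];  [:: 3; 1; 2; 8; 12];  [:: 5; 1; 2; 4; 7];
      [:: 3; 1; 2; 6; 9];   [:: 11; 1; 2; 4; 10]; [:: 3; 1; 2; 5; 8];
      [:: 7; 1; 2; 4; 6];   [:: 3; 1; 2; 12; 14]; [:: 5; 1; 2; 4; 9]].

Definition color (i p : nat) : nat := nth 0 (nth [::] pattern (i %% 12)) p.

Lemma color_bound i p : p < 5 -> 0 < color i p <= 14.
Proof.
move=> p5; rewrite /color; have: i %% 12 < 12 by rewrite ltn_mod.
move: (i %% 12) p p5 => r p p5 r12.
have: all (fun r => all (fun p => 0 < nth 0 (nth [::] pattern r) p <= 14)
  (iota 0 5)) (iota 0 12) by [].
by move=> /allP/(_ r)/[!mem_iota]/(_ r12)/allP/(_ p); rewrite mem_iota; apply.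
Qed.

Lemma color_inj i p q : p < 5 -> q < 5 -> color i p = color i q -> p = q.
Proof.
move=> p5 q5; rewrite /color; have: i %% 12 < 12 by rewrite ltn_mod.
move: (i %% 12) => r r12.
have: all (fun s => uniq s && (size s == 5)) pattern by [].
move/allP/(_ _ (mem_nth [::] (r12 : r < size pattern)))/andP=> [us /eqP ss].
by move/eqP; rewrite nth_uniq ?ss // => /eqP.
Qed.

Lemma color_gap i k p q : 0 < k -> p < 5 -> q < 5 -> color i p = color (i + k) q ->
  color i p < (p != 1) + k.*2.-1 + (q != 0).
Proof.
move=> k0 p5 q5 e; have [k8|k8] := leqP 8 k.
  by have /andP[_ c14] := color_bound i p5; lia.
move: e; rewrite /color -modnDml; have: i %% 12 < 12 by rewrite ltn_mod.
move: (i %% 12) => r r12 /eqP.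
have: all (fun r => all (fun k => all (fun p => all (fun q =>
    (nth 0 (nth [::] pattern r) p == nth 0 (nth [::] pattern ((r + k) %% 12)) q)
    ==> (nth 0 (nth [::] pattern r) p < (p != 1) + k.*2.-1 + (q != 0)))
  (iota 0 5)) (iota 0 5)) (iota 1 7)) (iota 0 12) by vm_compute.
move=> /allP/(_ r)/[!mem_iota]/(_ r12)/allP/(_ k)/[!mem_iota].
rewrite k0 => /(_ k8)/allP/(_ p)/[!mem_iota]/(_ p5)/allP/(_ q).
by rewrite mem_iota => /(_ q5)/implyP.
Qed.

Theorem theorem16 (t l : nat) (ht : 1 <= t) (hl : 2 <= l <= 5)
  (phi : 'I_((l * t) %/ l) -> subgraph_copy (path_graph l) (complete_graph 5)) :
  packing_chromatic_number (path_aligned_product phi) <= 14.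
Proof.
case: l hl phi => [|[|l]] // _ phi; apply: packing_chromatic_number_le.
pose col (w : path_aligned_product phi) := color w.1 (position w).
have colP w : 0 < col w <= 14 by apply/color_bound/position_lt.
apply/existsP; exists [ffun w => inord (col w).-1 : 'I_14].
apply/forallP => w; apply/forallP => z; rewrite !ffunE.
have colK x : (inord (col x).-1 : 'I_14).+1 = col x.
  by rewrite inordK; have := colP x; lia.
apply/implyP => wz; apply/implyP => /eqP/(congr1 (fun c : 'I_14 => c.+1)).
rewrite !colK addn1 => e; apply: chain_dist_ge; move: e.
rewrite /chain_dist !entryE !exitE /col.
have [pw pz] := (position_lt w, position_lt z).
case: (ltngtP w.1 z.1) => [lt|lt|/val_inj eq1] e.
- by apply: color_gap; rewrite ?subn_gt0 ?(subnKC (ltnW lt)).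
- by rewrite e; apply: color_gap; rewrite ?subn_gt0 ?(subnKC (ltnW lt)).
- case/eqP: wz; apply: position_inj => //; move: e; rewrite eq1.
  exact: color_inj.
Qed.
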